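(* Let $N\in\{1,2,3\}$, $1\le h\le N$, and let $\mathbf{C}=(C_1,\dots,C_n)$, $n\ge1$, be an arrangement of full-rank $(h+1)\times(N+1)$ complex matrices. Then $$\dim\mathcal{M}_{\mathbf{C}}^{N,h}=N$$ if and only if one of the following holds: (1) $h=N$; (2) $h=N-1$ and there are two disjoint point centers; (3) $h=N-2$ and there are three or more non-concurrent line centers.
   Context: A camera is a full-rank $(h+1)\times(N+1)$ matrix $C$; its center is $\mathbb{P}(\ker C)\subseteq\mathbb{P}^N$. The centers in question are those of the cameras $C_1,\dots,C_n$ of $\mathbf{C}$. The point multiview variety $\mathcal{M}_{\mathbf{C}}^{N,h}$ is the Zariski closure of the image of $\mathbb{P}^N\dashrightarrow(\mathbb{P}^h)^n$, $X\mapsto(C_1X,\dots,C_nX)$. Lines are concurrent if they meet in a common point. *)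

(* Defs.v *)
From mathcomp Require Import all_boot all_order all_algebra.
From mathcomp Require Import boolp classical_sets reals.
From mathcomp Require Import complex.
From mathcomp Require Import mpoly.

Set Implicit Arguments.
Unset Strict Implicit.
Unset Printing Implicit Defensive.

Import GRing.Theory.

Local Open Scope ring_scope.
Local Open Scope classical_set_scope.

(* P^m over K: the lines through the origin of K^(m+1). *)
Definition pspace (K : fieldType) (m : nat) :=
  {L : {vspace 'cV[K]_m.+1} | \dim L == 1%N}.

(* (P^m)^n *)
Definition mspace (K : fieldType) (n m : nat) := 'I_n -> pspace K m.

Section MultiprojectiveZariski.
Variables (K : fieldType) (n m : nat).

(* Polynomials in the homogeneous coordinates v i j of (P^m)^n, i < n, j <= m;
   the coordinate v i j is the variable of index [mxvec_index i j]. *)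
Definition mpeval (f : {mpoly K[n * m.+1]}) (v : 'I_n -> 'cV[K]_m.+1) : K :=
  f.@[fun k => mxvec (\matrix_(i < n, j < m.+1) v i j 0) 0 k].

Definition multihomogeneous (f : {mpoly K[n * m.+1]}) :=
  exists d : 'I_n -> nat, forall a, a \in msupp f ->
    forall i, (\sum_(j < m.+1) a (mxvec_index i j))%N = d i.

(* [v] ranges over all the systems of homogeneous coordinates of [x]; its
   vectors are nonzero because the lines [x i] have dimension 1. *)
Definition vanishes_at (f : {mpoly K[n * m.+1]}) (x : mspace K n m) :=
  forall v : 'I_n -> 'cV[K]_m.+1,
    (forall i, val (x i) = <[v i]>%VS) -> mpeval f v = 0.

Definition zariski_closed (Z : set (mspace K n m)) :=
  exists2 S : set {mpoly K[n * m.+1]},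
    S `<=` multihomogeneous & Z = [set x | forall f, S f -> vanishes_at f x].

Definition zariski_closure (A : set (mspace K n m)) : set (mspace K n m) :=
  smallest zariski_closed A.

Definition irreducible_closed (Z : set (mspace K n m)) :=
  [/\ zariski_closed Z, Z !=set0 &
      forall A B, zariski_closed A -> zariski_closed B ->
        Z `<=` A `|` B -> Z `<=` A \/ Z `<=` B].

(* Z 0 < Z 1 < ... < Z d *)
Definition irreducible_chain (V : set (mspace K n m)) (d : nat)
    (Z : nat -> set (mspace K n m)) :=
  (forall k, (k <= d)%N -> irreducible_closed (Z k) /\ Z k `<=` V) /\
  (forall k, (k < d)%N -> Z k `<` Z k.+1).

(* "dim V = d" for a Zariski closed V: the Krull dimension. V being closed, the
   irreducible closed subsets of the subspace V are those of (P^m)^n that are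
   contained in V. *)
Definition has_dim (V : set (mspace K n m)) (d : nat) :=
  (exists Z, irreducible_chain V d Z) /\
  (forall e Z, irreducible_chain V e Z -> (e <= d)%N).

End MultiprojectiveZariski.

Section Cameras.
Variables (K : fieldType) (N h : nat).

Definition center (C : 'M[K]_(h.+1, N.+1)) : set (pspace K N) :=
  [set X | (val X <= lker (linfun (mulmx C)))%VS].

(* The image of X |-> (C_1 X, ..., C_n X). The rational map is defined off the
   centers: if X lies in the center of C i, then C i maps the line X to 0, which
   is not a point of P^h. *)
Definition joint_image (n : nat) (C : 'I_n -> 'M[K]_(h.+1, N.+1)) :
    set (mspace K n h) :=
  [set x | exists X : pspace K N,
     forall i, ~ center (C i) X /\
       val (x i) = (linfun (mulmx (C i)) @: val X)%VS].

Definition multiview_variety (n : nat) (C : 'I_n -> 'M[K]_(h.+1, N.+1)) :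
    set (mspace K n h) :=
  zariski_closure (joint_image C).

Definition concurrent (n : nat) (C : 'I_n -> 'M[K]_(h.+1, N.+1))
    (I : {set 'I_n}) :=
  exists X : pspace K N, forall i, i \in I -> center (C i) X.

End Cameras.

(* Main.v *)
Require Import Defs.
From HB Require Import structures.
From mathcomp Require Import all_boot all_order all_algebra.
From mathcomp Require Import boolp classical_sets reals complex mpoly.

Set Implicit Arguments.
Unset Strict Implicit.
Unset Printing Implicit Defensive.
Import Order.TTheory GRing.Theory Num.Theory.

Local Open Scope ring_scope.
Local Open Scope classical_set_scope.

(** The multiview variety is the closure of the image of the projective space
    P^N under a linear rational map, so its dimension is at most N, and the
    question is when some chain of irreducible closed subsets has length N.

    Upper bounds come from counting polynomials instead of transcendence
    degrees. A chain Z_0 < ... < Z_e yields forms F_0, ..., F_e of one common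
    multidegree such that F_k vanishes on Z_(k-1) but not on Z_k
    ([chain_forms]); such forms satisfy no homogeneous polynomial relation on
    Z_e ([chain_independence]). If the variety is parametrized by r affine
    parameters, the F_k become e + 1 polynomials in r variables, and comparing
    numbers of monomials gives a relation as soon as e > r
    ([homogeneous_dependence]). Hence e <= r ([chain_length_le]). The
    parametrizations needed are those in which every camera factors through
    one of G fixed linear maps to a space of dimension s + 1, which leaves
    r = G s parameters ([factored_chain_length]):
    - the identity always works and gives e <= N;
    - if all the centers share a point, the projection from that point gives
      e <= N - 1; this settles h = N - 1 when no two centers are disjoint and
      h = N - 2 when the line centers are concurrent;
    - if there are at most two distinct line centers in P^3, two maps to the
      plane K^2 give e <= 2.

    For the converse, consider N linearly independent linear forms, each
    factoring through a camera, whose common zero v lies on no center. They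
    cut out a flag from the line of v to K^(N+1). The closures of the images
    of its subspaces are irreducible, and each inclusion is strict because the
    form defining a step is the pullback of a form on one of the factors
    ([chain_from_flag]). To say that v is off the center of the camera j is to
    say that a form factoring through C_j completes the N forms to a basis of
    the dual space. Each such condition is open, so it is enough to satisfy
    them one camera at a time ([common_flag]), and Rado's theorem on
    independent transversals ([independent_transversal]) turns this into
    inequalities between ranks of sums of row spaces of the cameras
    ([chain_from_rank_condition]). These hold in each of the three cases.

    Every genericity argument takes place on a line, where it amounts to a
    nonzero polynomial in one variable having a nonroot. *)

(** * Generic points on a line *)

Section GenericParameters.
Variable K : numFieldType.

Lemma poly_has_nonroot (p : {poly K}) : p != 0 -> exists t, p.[t] != 0.
Proof.
move=> p_neq0; pose rs : seq K := [seq k%:R | k <- iota 0 (size p)].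
have rs_uniq : uniq rs.
  by rewrite map_inj_uniq ?iota_uniq // => k l /eqP; rewrite eqr_nat => /eqP.
have /allPn[t _ pt] : ~~ all (root p) rs.
  apply/negP => /(max_poly_roots p_neq0)/(_ rs_uniq).
  by rewrite size_map size_iota ltnn.
by exists t.
Qed.

Lemma poly_eq0_from_values (p : {poly K}) : (forall t, p.[t] = 0) -> p = 0.
Proof.
move=> p0; apply/eqP; apply: contraT => /poly_has_nonroot[t].
by rewrite p0 eqxx.
Qed.

(** Being true off the roots of a nonzero polynomial means being true for all
    but finitely many parameters; unlike cofiniteness, this form is what
    evaluating a polynomial condition along a line produces, and it is stable
    under finite conjunction by multiplying the polynomials. *)
Definition generic (P : K -> Prop) :=
  exists2 p : {poly K}, p != 0 & forall t, p.[t] != 0 -> P t.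

Lemma generic_ex P : generic P -> exists t, P t.
Proof. by case=> p /poly_has_nonroot[t pt] pP; exists t; apply: pP. Qed.

Lemma generic_weaken (P Q : K -> Prop) :
  (forall t, P t -> Q t) -> generic P -> generic Q.
Proof. by move=> PQ [p p0 pP]; exists p => // t /pP/PQ. Qed.

Lemma genericT (P : K -> Prop) : (forall t, P t) -> generic P.
Proof. by move=> Pt; exists 1; rewrite ?oner_neq0. Qed.

Lemma genericI P Q : generic P -> generic Q -> generic (fun t => P t /\ Q t).
Proof.
move=> [p p0 pP] [q q0 qQ]; exists (p * q); first by rewrite mulf_neq0.
by move=> t; rewrite hornerM mulf_eq0 negb_or => /andP[/pP Pt /qQ].
Qed.

Lemma generic_all (T : eqType) (s : seq T) (P : T -> K -> Prop) :
  {in s, forall k, generic (P k)} -> generic (fun t => {in s, forall k, P k t}).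
Proof.
elim: s => [|k s IH] gP; first exact: genericT.
have gs : generic (fun t => {in s, forall l, P l t}).
  by apply: IH => l ls; apply: gP; rewrite inE ls orbT.
apply: generic_weaken (genericI (gP k (mem_head _ _)) gs) => t [Pk Ps] l.
by rewrite inE => /predU1P[->|/Ps].
Qed.

Lemma generic_forall (T : finType) (P : T -> K -> Prop) :
  (forall k, generic (P k)) -> generic (fun t => forall k, P k t).
Proof.
move=> gP; have := @generic_all _ (enum T) P (fun k _ => gP k).
by apply: generic_weaken => t Pt k; apply: Pt; rewrite mem_enum.
Qed.

Lemma generic_nonroot (p : {poly K}) : p != 0 -> generic (fun t => p.[t] != 0).
Proof. by exists p. Qed.

Definition line_poly m n (A B : 'M[K]_(m, n)) i j : {poly K} :=
  (A i j)%:P + B i j *: 'X.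

Lemma horner_line_poly m n (A B : 'M[K]_(m, n)) i j t :
  (line_poly A B i j).[t] = (A + t *: B) i j.
Proof. by rewrite /line_poly !hornerE !mxE mulrC. Qed.

Lemma generic_line_neq0 m n (A B : 'M[K]_(m, n)) :
  (A != 0) || (B != 0) -> generic (fun t => A + t *: B != 0).
Proof.
move=> AB; have [i [j AB']] : exists i j, (A i j != 0) || (B i j != 0).
  case/orP: AB => /matrix0Pn[i [j ij0]]; exists i, j; by rewrite ij0 ?orbT.
exists (line_poly A B i j).
  apply: contraTneq AB' => p0.
  have c0 : (line_poly A B i j)`_0 = A i j.
    by rewrite coefD coefC coefZ coefX mulr0 addr0.
  have c1 : (line_poly A B i j)`_1 = B i j.
    by rewrite coefD coefC coefZ coefX mulr1 add0r.
  by rewrite -c0 -c1 p0 !coef0 eqxx.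
by move=> t; rewrite horner_line_poly; apply: contra_neq => ->; rewrite mxE.
Qed.

Lemma det_line n (A B : 'M[K]_n) :
  exists p : {poly K}, forall t, p.[t] = \det (A + t *: B).
Proof.
exists (\det (\matrix_(i, j) line_poly A B i j)) => t.
rewrite -[_.[t]]/(horner_eval t _) -det_map_mx; congr (\det _).
by apply/matrixP => i j; rewrite [LHS]mxE [in LHS]mxE; apply: horner_line_poly.
Qed.

Lemma mpeval_line n m (f : {mpoly K[n * m.+1]}) (v w : 'I_n -> 'cV[K]_m.+1) :
  exists p : {poly K}, forall t, p.[t] = mpeval f (fun i => v i + t *: w i).
Proof.
pose M (u : 'I_n -> 'cV[K]_m.+1) := mxvec (\matrix_(i < n, j < m.+1) u i j 0).
exists (mmap polyC (fun k => line_poly (M v) (M w) 0 k) f) => t.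
rewrite /mpeval mevalE /mmap horner_sum; apply: eq_bigr => a _.
rewrite hornerM hornerC horner_prod; congr (_ * _); apply: eq_bigr => k _.
rewrite horner_exp horner_line_poly; congr (_ ^+ _).
by case/mxvec_indexP: k => i j; rewrite !mxE !mxvecE !mxE.
Qed.

End GenericParameters.

(** * Independent transversals *)

Section Transversal.
Variable K : numFieldType.

(** A vector space over an infinite field is not a finite union of proper
    subspaces: a vector avoiding the first ones is moved along a line towards a
    vector avoiding the next one. *)
Lemma avoid_subspaces (J : finType) D m (U : 'M[K]_(m, D)) (S : J -> 'M[K]_D) :
  exists2 y : 'rV_D, (y <= U)%MS &
    forall j, ~~ (U <= S j)%MS -> ~~ (y <= S j)%MS.
Proof.
suff [y yU yS] : exists2 y : 'rV_D, (y <= U)%MS &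
    {in enum J, forall j, ~~ (U <= S j)%MS -> ~~ (y <= S j)%MS}.
  by exists y => // j; apply: yS; rewrite mem_enum.
elim: (enum J) => [|j s [y yU yS]]; first by exists 0; rewrite ?sub0mx.
case: (boolP (U <= S j)%MS) => [UjS|/row_subPn[i UiS]].
  exists y => // k; rewrite inE => /predU1P[->|/yS //].
  by rewrite UjS.
pose good k t := ~~ (U <= S k)%MS -> ~~ ((y + t *: row i U)%R <= S k)%MS.
have [t yt] : exists t, {in j :: s, forall k, good k t}.
  apply/generic_ex/generic_all => k ks; rewrite /good.
  case: (boolP (U <= S k)%MS) => [_|UkS]; first exact: genericT.
  have : (y *m cokermx (S k) != 0) || (row i U *m cokermx (S k) != 0).
    move: ks; rewrite inE => /predU1P[->|/yS/(_ UkS)].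
      by move: UiS; rewrite submxE => ->; rewrite orbT.
    by rewrite submxE => ->.
  move/generic_line_neq0; apply: generic_weaken => t ne _.
  by rewrite submxE mulmxDl -scalemxAl.
exists (y + t *: row i U) => //.
by rewrite addmx_sub ?scalemx_sub ?row_sub.
Qed.

Lemma mxrank_add_row D m (S : 'M[K]_(m, D)) (y : 'rV_D) :
  ~~ (y <= S)%MS -> \rank (S + y)%MS = (\rank S).+1.
Proof.
move=> yS; apply/eqP; rewrite eqn_leq; apply/andP; split.
  rewrite (leq_trans (mxrank_adds_leqif _ _)) // -[(\rank S).+1]addn1.
  by rewrite leq_add2l rank_leq_row.
rewrite ltn_neqAle mxrankS ?addsmxSl // andbT; apply: contraNneq yS => eq_rk.
have [_ /esym] := mxrank_leqif_sup (addsmxSl S y).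
by rewrite eq_rk eqxx; apply: submx_trans (addsmxSr S y).
Qed.

(** Rado's condition, relative to a subspace [B]. A vector [y] of one of the
    subspaces is chosen outside each [B + \sum_(j in J) U j] that does not
    contain it, and then added to [B]. The condition for the other subspaces
    survives: if such a sum contains [U a], it equals the sum over [a |: J],
    whose rank has one more unit to spare; if not, [y] raises its rank. *)
Lemma independent_transversal (T : finType) D (U : T -> 'M[K]_D) (A : {set T})
    (B : 'M[K]_D) :
  (forall J : {set T}, J \subset A ->
     \rank B + #|J| <= \rank (B + \sum_(j in J) U j)%MS)%N ->
  exists x : T -> 'rV[K]_D, (forall j, j \in A -> (x j <= U j)%MS) /\
    (\rank B + #|A| <= \rank (B + \sum_(j in A) <<x j>>)%MS)%N.
Proof.
elim: {A}_.+1 {-2}A (ltnSn #|A|) B => // k IH A leAk B rado.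
have [->|[a aA]] := set_0Vmem A.
  exists (fun=> 0); split=> [j|]; first by rewrite inE.
  by rewrite cards0 addn0 mxrankS ?addsmxSl.
pose A' := A :\ a; pose S (J : {set T}) := (B + \sum_(j in J) U j)%MS.
have [y yU yS] := avoid_subspaces (U a) S.
have rkJ (J : {set T}) : J \subset A' ->
    (\rank B + 1 + #|J| <= \rank ((B + y)%MS + \sum_(j in J) U j)%MS)%N.
  move=> JA'; have [JA aJ] : J \subset A /\ a \notin J.
    by move: JA'; rewrite subsetD1 => /andP[].
  have eqS : ((B + y)%MS + \sum_(j in J) U j = S J + y)%MS.
    by rewrite -!addsmxA [(y + _)%MS]addsmxC.
  rewrite eqS; case: (boolP (U a <= S J)%MS) => UaS; last first.
    by rewrite mxrank_add_row ?yS // addn1 addSn ltnS rado.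
  have Ja : a |: J \subset A by rewrite finset.subUset finset.sub1set aA.
  have := rado _ Ja; rewrite cardsU1 aJ big_setU1 //= addnA => /leq_trans; apply.
  apply: mxrankS; apply: submx_trans (addsmxSl (S J) y).
  by rewrite !addsmx_sub addsmxSl UaS addsmxSr.
have rkBy : \rank (B + y)%MS = (\rank B + 1)%N.
  have yB : ~~ (y <= S finset.set0)%MS.
    apply: yS; rewrite /S big_set0; apply/negP => UaB.
    have := rado [set a]%SET; rewrite finset.sub1set aA cards1 big_set1 => /(_ isT).
    have /eqmxP -> : (B + U a == B)%MS.
      rewrite addsmx_sub submx_refl (submx_trans UaB) ?addsmxSl //.
      by rewrite addsmx_sub submx_refl sub0mx.
    by rewrite addn1 ltnn.
  rewrite mxrank_add_row ?addn1 //; apply: contra yB => /submx_trans; apply.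
  exact: addsmxSl.
have [||x [xU rkx]] := IH A' _ (B + y)%MS.
- by move: leAk; rewrite (cardsD1 a) aA.
- by move=> J /rkJ; rewrite rkBy.
exists (fun j => if j == a then y else x j); split=> [j jA|].
  case: eqP => [->//|/eqP ja]; apply: xU; by rewrite !inE ja.
rewrite (cardsD1 a A) aA addnA -rkBy; apply: leq_trans rkx _.
rewrite (big_setD1 a aA) /= eqxx addsmxA; apply: mxrankS; apply: addsmxS.
  by apply: addsmxS; rewrite ?genmxE.
apply/sumsmx_subP => j jA'; apply: (sumsmx_sup j) => //.
by move: jA'; rewrite !inE => /andP[/negPf -> _].
Qed.

End Transversal.

(** * Multidegrees and the Zariski topology *)

Lemma mxvec_index_eq n m (i k : 'I_n) (j l : 'I_m) :
  (mxvec_index i j == mxvec_index k l) = (i == k) && (j == l).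
Proof.
rewrite -xpair_eqE; apply/eqP/eqP => [|[-> ->]] //.
by move/cast_ord_inj/enum_rank_inj.
Qed.

Section Multidegree.
Variables (n m : nat).

Definition mdeg_at (i : 'I_n) (a : 'X_{1..n * m.+1}) :=
  (\sum_(j < m.+1) a (mxvec_index i j))%N.

Lemma mdeg_at0 i : mdeg_at i 0%MM = 0%N.
Proof. by rewrite /mdeg_at big1 // => j _; rewrite mnm0E. Qed.

Lemma mdeg_atD i : {morph mdeg_at i : a b / (a + b)%MM >-> (a + b)%N}.
Proof.
by move=> a b; rewrite -big_split; apply: eq_bigr => j _; rewrite mnmDE.
Qed.

HB.instance Definition _ i :=
  isMeasure.Build _ (mdeg_at i) (mdeg_at0 i) (mdeg_atD i).

End Multidegree.

Section Multihomogeneous.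
Variables (K : fieldType) (n m : nat).
Implicit Types (f g : {mpoly K[n * m.+1]}) (v w : 'I_n -> 'cV[K]_m.+1).
Implicit Types (d : 'I_n -> nat) (x : mspace K n m).

Definition has_multidegree d f := forall i, f \is (d i).-homog for (mdeg_at i).

Lemma multihomogeneousP f :
  multihomogeneous f <-> exists d, has_multidegree d f.
Proof.
split=> [[d fd]|[d fd]]; exists d.
  by move=> i; apply/dhomogP => a /fd; apply.
by move=> a af i; have /dhomogP/(_ a af) := fd i.
Qed.

Lemma has_multidegreeM d e f g : has_multidegree d f -> has_multidegree e g ->
  has_multidegree (fun i => (d i + e i)%N) (f * g).
Proof. by move=> fd ge i; apply: dhomogM. Qed.

Lemma has_multidegreeX d f k : has_multidegree d f ->
  has_multidegree (fun i => (d i * k)%N) (f ^+ k).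
Proof. by move=> fd i; apply: dhomogMn. Qed.

Lemma has_multidegree1 : has_multidegree (fun=> 0%N) 1.
Proof. by move=> i; apply: dhomog1. Qed.

Lemma has_multidegree_prod (I : Type) (r : seq I) (d : I -> 'I_n -> nat)
    (F : I -> {mpoly K[n * m.+1]}) : (forall k, has_multidegree (d k) (F k)) ->
  has_multidegree (fun i => \sum_(k <- r) d k i)%N (\prod_(k <- r) F k).
Proof.
move=> Fd i; elim: r => [|k r IH]; first by rewrite !big_nil; apply: dhomog1.
by rewrite !big_cons; apply: dhomogM => //; apply: Fd.
Qed.

Lemma mpevalM f g v : mpeval (f * g) v = mpeval f v * mpeval g v.
Proof. exact: mevalM. Qed.

Lemma mpeval_prod (I : Type) (r : seq I) (F : I -> {mpoly K[n * m.+1]}) v :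
  mpeval (\prod_(k <- r) F k) v = \prod_(k <- r) mpeval (F k) v.
Proof. exact: rmorph_prod. Qed.

Lemma mpevalX f k v : mpeval (f ^+ k) v = mpeval f v ^+ k.
Proof. exact: rmorphXn. Qed.

Lemma mpeval_var i j v : mpeval 'X_(mxvec_index i j) v = v i j 0.
Proof. by rewrite /mpeval mevalXU mxvecE mxE. Qed.

Lemma has_multidegree_var i j :
  has_multidegree (fun k => (k == i) : nat) ('X_(mxvec_index i j)).
Proof.
move=> k; rewrite dhomogX; apply/eqP; rewrite /= /mdeg_at.
have uE l : (U_(mxvec_index i j)%MM (mxvec_index k l) = ((k == i) && (l == j) : nat))%N.
  by rewrite mnm1E mxvec_index_eq (eq_sym k) (eq_sym l).
rewrite (bigD1 j) //= uE eqxx andbT big1 ?addn0 // => l /negPf lj.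
by rewrite uE lj andbF.
Qed.

(** Vanishing of a multihomogeneous polynomial does not depend on the choice of
    homogeneous coordinates. *)
Lemma mpeval_scale d f v (c : 'I_n -> K) : has_multidegree d f ->
  mpeval f (fun i => c i *: v i) = (\prod_i c i ^+ d i) * mpeval f v.
Proof.
move=> fd; rewrite /mpeval !mevalE big_distrr /= big_seq [RHS]big_seq.
apply: eq_bigr => a af; rewrite mulrCA; congr (_ * _).
have prodE (w : 'I_n -> 'cV[K]_m.+1) :
    \prod_k (mxvec (\matrix_(i < n, j < m.+1) w i j 0) 0 k) ^+ a k
    = \prod_i \prod_j (w i j 0) ^+ a (mxvec_index i j).
  rewrite (reindex _ (curry_mxvec_bij n m.+1)) pair_big /=.
  by apply: eq_bigr => -[i j] _ /=; rewrite mxvecE mxE.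
rewrite !prodE -big_split; apply: eq_bigr => i _ /=.
have /dhomogP/(_ a af) <- := fd i.
rewrite /= /mdeg_at expr_sum -big_split; apply: eq_bigr => j _ /=.
by rewrite mxE exprMn.
Qed.

Lemma pspace_rep (X : pspace K m) : exists2 v : 'cV_m.+1, v != 0 & val X = <[v]>%VS.
Proof.
have X0 : val X != 0%VS by rewrite -dimv_eq0 (eqP (valP X)).
exists (vpick (val X)); first by rewrite vpick0.
apply/eqP; rewrite eq_sym eqEdim dim_vline vpick0 X0 (eqP (valP X)).
by rewrite -memvE memv_pick.
Qed.

Lemma pspace_of (v : 'cV[K]_m.+1) : v != 0 -> exists X : pspace K m, val X = <[v]>%VS.
Proof.
move=> v0; have Xv : \dim <[v]> == 1%N by rewrite dim_vline v0.
by exists (exist _ <[v]>%VS Xv).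
Qed.

Lemma eq_vline (v w : 'cV[K]_m.+1) : v != 0 -> <[v]>%VS = <[w]>%VS ->
  exists2 c, c != 0 & w = c *: v.
Proof.
move=> v0 vw; have /vlineP[c wE] : w \in <[v]>%VS by rewrite vw memv_line.
exists c => //; apply: contraNneq v0 => c0.
have: v \in <[w]>%VS by rewrite -vw memv_line.
by case/vlineP=> k ->; rewrite wE c0 scale0r scaler0.
Qed.

Definition represents v x := forall i, val (x i) = <[v i]>%VS.

Lemma mspace_rep x : exists v, represents v x.
Proof.
have /choice[v vx] : forall i, exists u : 'cV_m.+1, val (x i) = <[u]>%VS.
  by move=> i; have [u _ ux] := pspace_rep (x i); exists u.
by exists v.
Qed.

Lemma represents_neq0 v x i : represents v x -> v i != 0.
Proof.
by move=> vx; have := valP (x i); rewrite (vx i) dim_vline; case: (v i != 0).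
Qed.

Lemma mspace_of v : (forall i, v i != 0) -> exists x, represents v x.
Proof.
move=> v0; have /choice[x xv] : forall i, exists X : pspace K m, val X = <[v i]>%VS.
  by move=> i; apply: pspace_of.
by exists x.
Qed.

Lemma vanishes_atE f v x : multihomogeneous f -> represents v x ->
  vanishes_at f x <-> mpeval f v = 0.
Proof.
move=> /multihomogeneousP[d fd] vx; split=> [|fv0 w wx]; first exact.
have /choice[c cP] : forall i, exists c : K, w i = c *: v i.
  move=> i; have [||c _ ->] := @eq_vline (v i) (w i); last by exists c.
    exact: represents_neq0 vx.
  by rewrite -(vx i) (wx i).
have -> : w = (fun i => c i *: v i) by apply: funext.
by rewrite (mpeval_scale _ _ fd) fv0 mulr0.
Qed.

Lemma vanishes_atM f g x : multihomogeneous f -> multihomogeneous g ->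
  vanishes_at (f * g) x <-> vanishes_at f x \/ vanishes_at g x.
Proof.
move=> fh gh; have [v vx] := mspace_rep x.
have fgh : multihomogeneous (f * g).
  have [[d fd] [e ge]] := ((multihomogeneousP f).1 fh, (multihomogeneousP g).1 gh).
  by apply/multihomogeneousP; exists (fun i => (d i + e i)%N); apply: has_multidegreeM.
rewrite (vanishes_atE fgh vx) (vanishes_atE fh vx) (vanishes_atE gh vx) mpevalM.
split=> [/eqP|[->|->]]; rewrite ?mul0r ?mulr0 //.
by rewrite mulf_eq0 => /orP[]/eqP; [left|right].
Qed.

Lemma closed_vanishing f : multihomogeneous f ->
  zariski_closed [set x | vanishes_at f x].
Proof.
move=> fh; exists [set f]; first by move=> _ ->.
by apply/seteqP; split=> x /=; [move=> fx _ ->|apply].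
Qed.

Lemma zariski_closure_sub (A Z : set (mspace K n m)) :
  zariski_closed Z -> A `<=` Z -> zariski_closure A `<=` Z.
Proof. by move=> Zc AZ; apply: smallest_sub. Qed.

Lemma sub_zariski_closure (A : set (mspace K n m)) : A `<=` zariski_closure A.
Proof. exact: sub_gen_smallest. Qed.

Lemma closed_zariski_closure (A : set (mspace K n m)) :
  zariski_closed (zariski_closure A).
Proof.
exists [set f | multihomogeneous f /\ forall y, A y -> vanishes_at f y].
  by move=> f [].
apply/seteqP; split=> [x Ax f [fh fA]|x xf Z [[S Sh ->] AS] f Sf].
  by apply: (zariski_closure_sub (closed_vanishing fh) _ Ax).
by apply: xf; split=> [|y /AS]; [apply: Sh|apply].
Qed.

(** The multihomogeneous ideal of an irreducible closed set is prime. *)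
Lemma irreducible_vanishingM (Z : set (mspace K n m)) f g :
  irreducible_closed Z -> multihomogeneous f -> multihomogeneous g ->
  (exists2 x, Z x & ~ vanishes_at f x) -> (exists2 x, Z x & ~ vanishes_at g x) ->
  exists2 x, Z x & ~ vanishes_at (f * g) x.
Proof.
move=> [_ _ Zirr] fh gh [x Zx fx] [y Zy gy]; apply: contrapT => fg0.
have [|Zf|Zg] := Zirr _ _ (closed_vanishing fh) (closed_vanishing gh).
- move=> z Zz; apply/(vanishes_atM _ fh gh); apply: contrapT => fgz.
  by apply: fg0; exists z.
- exact: fx (Zf _ Zx).
- exact: gy (Zg _ Zy).
Qed.

End Multihomogeneous.

(** * Algebraic independence along a chain *)

Section SetVariableToZero.
Variables (K : fieldType) (q : nat) (P : {mpoly K[q]}) (k : 'I_q).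

(** The polynomial [Q] is [P] with the [k]-th variable set to 0; keeping the
    number of variables unchanged avoids renumbering them. *)
Lemma mpoly_at_var0 (m0 : 'X_{1..q}) : m0 \in msupp P -> m0 k = 0%N ->
  exists Q : {mpoly K[q]}, [/\ Q != 0,
    {subset msupp Q <= [seq m : 'X_{1..q} <- msupp P | m k == 0%N]} &
    forall a, a k = 0 -> P.@[a] = Q.@[a]].
Proof.
move=> m0P m0k; pose s := [seq m : 'X_{1..q} <- msupp P | m k == 0%N].
pose Q := \sum_(m <- s) P@_m *: 'X_[m].
have suppQ : perm_eq (msupp Q) s.
  apply: msupp_sumX; first by rewrite filter_uniq ?msupp_uniq.
  by move=> m; rewrite mem_filter mcoeff_msupp => /andP[].
exists Q; split=> [||a ak].
- rewrite -msupp_eq0; apply/eqP => Q0.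
  have : m0 \in msupp Q by rewrite (perm_mem suppQ) mem_filter m0k.
  by rewrite Q0.
- by move=> m; rewrite (perm_mem suppQ).
rewrite [in LHS](mpolyE P) /Q !raddf_sum big_filter [RHS]big_mkcond /=.
apply: eq_bigr => m _; case: ifP => // /negbT mk; rewrite mevalZ mevalX.
by rewrite (bigD1 k) //= ak expr0n (negPf mk) mul0r mulr0.
Qed.

Lemma mpoly_div_var : {in msupp P, forall m : 'X_{1..q}, m k != 0%N} ->
  exists Q, P = Q * 'X_k.
Proof.
move=> Pk; exists (\sum_(m <- msupp P) P@_m *: 'X_[m - U_(k)]).
rewrite [LHS]mpolyE big_distrl big_seq [RHS]big_seq; apply: eq_bigr => m mP /=.
by rewrite -scalerAl -mpolyXD submK // lep1mP Pk.
Qed.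

End SetVariableToZero.

Section ChainForms.
Variables (K : fieldType) (n m e : nat).
Variables (V : set (mspace K n m)) (Z : nat -> set (mspace K n m)).
Hypothesis Zchain : irreducible_chain V e Z.

Lemma chain_mono k l : (k <= l <= e)%N -> Z k `<=` Z l.
Proof.
elim: l => [|l IH]; first by rewrite leqn0 => /andP[/eqP-> _].
case/andP; rewrite leq_eqVlt => /predU1P[-> _ x //|]; rewrite ltnS => kl le.
have [_ /(_ l le) [ZlS _]] := Zchain.
by apply: subset_trans ZlS; apply: IH; rewrite kl ltnW.
Qed.

Lemma chain_separating_form k : (k < e)%N ->
  exists f : {mpoly K[n * m.+1]}, [/\ multihomogeneous f,
    forall x, Z k x -> vanishes_at f x &
    exists2 x, Z k.+1 x & ~ vanishes_at f x].
Proof.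
move=> ke; have [Zirr Zlt] := Zchain.
have [[[S Sh ZkE] _ _] _] := Zirr _ (ltnW ke).
have [_ /nonsubset[x [Zx]]] := Zlt k ke.
rewrite ZkE /= => /existsNP[f /not_implyP[Sf fx]].
exists f; split=> [|y|]; [exact: Sh|by apply|by exists x].
Qed.

(** The separating forms of the successive steps have unrelated multidegrees.
    They are completed to the common multidegree [D] by powers of coordinates
    that do not vanish at a chosen point of [Z 0], hence not identically on any
    [Z k]. *)
Lemma chain_forms : exists D (F : e.+1.-tuple {mpoly K[n * m.+1]}),
  [/\ forall k, has_multidegree D (tnth F k),
      forall (k : 'I_e.+1) l x, (l < k)%N -> Z l x -> vanishes_at (tnth F k) x &
      forall k : 'I_e.+1, exists2 x, Z k x & ~ vanishes_at (tnth F k) x].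
Proof.
have [Zirr _] := Zchain.
have irr k : (k <= e)%N -> irreducible_closed (Z k) by move=> /Zirr[].
have [[_ [x0 Zx0] _] _] := Zirr 0 (leq0n e).
have [v vx0] := mspace_rep x0.
have /choice[j vj] : forall i, exists j, v i j 0 != 0.
  by move=> i; have /matrix0Pn[j [z]] := represents_neq0 i vx0; rewrite ord1; exists j.
have /choice[dh dhP] : forall k : 'I_e.+1, exists dh : ('I_n -> nat) * {mpoly K[n * m.+1]},
    [/\ has_multidegree dh.1 dh.2,
      forall l x, (l < k)%N -> Z l x -> vanishes_at dh.2 x &
      exists2 x, Z k x & ~ vanishes_at dh.2 x].
  move=> [[|k] /= ke].
    have md1 := @has_multidegree1 K n m.
    have h1 : multihomogeneous (1 : {mpoly K[n * m.+1]}).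
      by apply/multihomogeneousP; exists (fun=> 0%N).
    exists (fun=> 0%N, 1); split=> //; exists x0 => // /(vanishes_atE h1 vx0)/eqP.
    by rewrite /mpeval meval1 oner_eq0.
  have [f [/multihomogeneousP[d fd] fZ nfZ]] := chain_separating_form ke.
  exists (d, f); split=> // l x lk Zlx; apply: fZ.
  by apply: (@chain_mono l) Zlx; rewrite -ltnS lk ltnW.
(* Any multidegree dominating all of them would do; the sum does. *)
pose D i := (\sum_k (dh k).1 i)%N.
pose G k := \prod_i ('X_(mxvec_index i (j i)) : {mpoly K[n * m.+1]}) ^+ (D i - (dh k).1 i).
have Gd k : has_multidegree (fun i => D i - (dh k).1 i)%N (G k).
  have Gi l := has_multidegreeX (D l - (dh k).1 l)%N (@has_multidegree_var K n m l (j l)).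
  move=> i; have <- : (\sum_l (i == l) * (D l - (dh k).1 l) = D i - (dh k).1 i)%N.
    by rewrite (bigD1 i) //= eqxx mul1n big1 ?addn0 // => l /negPf li; rewrite eq_sym li.
  exact: (has_multidegree_prod (index_enum 'I_n) Gi i).
have Gh k : multihomogeneous (G k).
  by apply/multihomogeneousP; exists (fun i => D i - (dh k).1 i)%N.
have hh k : multihomogeneous (dh k).2.
  by apply/multihomogeneousP; exists (dh k).1; case: (dhP k).
exists D, [tuple (dh k).2 * G k | k < e.+1]; split=> k.
- rewrite tnth_mktuple => i; rewrite -(@subnKC ((dh k).1 i) (D i)).
    by apply: dhomogM (Gd k i); case: (dhP k) => /(_ i).
  by rewrite /D (bigD1 k) //= leq_addr.
- move=> l x lk Zlx; rewrite tnth_mktuple; apply/vanishes_atM => //.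
  by left; case: (dhP k) => _ /(_ l x lk Zlx).
rewrite tnth_mktuple; apply: irreducible_vanishingM => //; first exact: irr (ltn_ord k).
  by case: (dhP k).
exists x0; first by apply: (@chain_mono 0) Zx0; rewrite leq_ord.
move/(vanishes_atE (Gh k) vx0)/eqP; apply/negP; rewrite mpeval_prod.
by apply/prodf_neq0 => i _; rewrite mpevalX expf_neq0 // mpeval_var.
Qed.

End ChainForms.

Section CompositeMultidegree.
Variables (K : fieldType) (n m q : nat) (D : 'I_n -> nat).
Variable F : q.-tuple {mpoly K[n * m.+1]}.
Hypothesis FD : forall k, has_multidegree D (tnth F k).

Lemma has_multidegree_comp (P : {mpoly K[q]}) T : P \is T.-homog ->
  has_multidegree (fun i => (D i * T)%N) (P \mPo F).
Proof.
move=> /dhomogP PT i; rewrite comp_mpolyE big_seq; apply: rpred_sum => a aP.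
apply: rpredZ; rewrite -(PT a aP) /= mdegE big_distrr /=.
elim/big_rec2: _ => [|k g d _ gd]; first exact: dhomog1.
by apply: dhomogM gd; apply: dhomogMn; apply: FD.
Qed.

Lemma mpeval_comp (P : {mpoly K[q]}) v :
  mpeval (P \mPo F) v = P.@[fun k => mpeval (tnth F k) v].
Proof. exact: comp_mpoly_meval. Qed.

End CompositeMultidegree.

Section ChainIndependence.
Variables (K : fieldType) (n m e : nat).
Variables (V : set (mspace K n m)) (Z : nat -> set (mspace K n m)).
Hypothesis Zchain : irreducible_chain V e Z.
Variables (D : 'I_n -> nat) (F : e.+1.-tuple {mpoly K[n * m.+1]}).
Hypothesis FD : forall k, has_multidegree D (tnth F k).
Hypothesis FZ : forall (k : 'I_e.+1) l x, (l < k)%N -> Z l x -> vanishes_at (tnth F k) x.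
Hypothesis FZ' : forall k : 'I_e.+1, exists2 x, Z k x & ~ vanishes_at (tnth F k) x.

Let comp_multihomogeneous P T : P \is T.-homog -> multihomogeneous (P \mPo F).
Proof.
move=> PT; apply/multihomogeneousP; exists (fun i => D i * T)%N.
exact: has_multidegree_comp.
Qed.

Let constant_case k T P : (k <= e)%N -> P != 0 -> P \is T.-homog ->
  {in msupp P, forall a, a = 0%MM} ->
  exists2 x, Z k x & ~ vanishes_at (P \mPo F) x.
Proof.
move=> ke P0 PT supp0; have [Zirr _] := Zchain.
have [[_ [x Zx] _] _] := Zirr k ke; exists x => //.
have [v vx] := mspace_rep x.
move/(vanishes_atE (comp_multihomogeneous PT) vx)/eqP; apply/negP.
have -> : P = (P@_0%MM)%:MP.
  apply/mpolyP => a; rewrite mcoeffC; have [->|a0] := eqVneq a 0%MM; rewrite ?mulr1 ?mulr0 //.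
  by apply: memN_msupp_eq0; apply: contra a0 => /supp0 ->.
rewrite mpeval_comp mevalC -mcoeff_msupp.
by have /mlead_supp := P0 => leadP; rewrite -(supp0 _ leadP).
Qed.

(** Induction on the number [k] of variables that occur in [P]. Dividing by the
    last variable as long as possible (on [Z k.-1] its form is not identically
    zero, and irreducibility allows the division), some monomial of [P] is free
    of it. Setting that variable to 0 leaves a nonzero polynomial in fewer
    variables, which by induction does not vanish identically on the previous
    member of the chain, where the form of the last variable is 0. The member
    attached to [k] variables is [Z k.-1], because the variables are numbered
    from 0. *)
Lemma chain_independence k T (P : {mpoly K[e.+1]}) : (k <= e.+1)%N ->
  P != 0 -> P \is T.-homog ->
  (forall a (i : 'I_e.+1), a \in msupp P -> (k <= i)%N -> a i = 0%N) ->
  exists2 x, Z k.-1 x & ~ vanishes_at (P \mPo F) x.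
Proof.
have [Zirr _] := Zchain.
elim: k T P => [|k IHk] T P ke P0 PT Pk.
  apply: (constant_case (k := 0) _ P0 PT) => // a aP.
  by apply/mnmP => i; rewrite mnm0E (Pk a).
elim: T P P0 PT Pk => [|T IHT] P P0 PT Pk.
  apply: (constant_case (k := k) _ P0 PT) => // a aP.
  by apply/eqP; rewrite -mdeg_eq0; apply/eqP; move/dhomogP: PT => /(_ a aP).
pose j := Ordinal ke.
have [/allP Pj|/allPn[a aP]] := boolP (all (fun a : 'X_{1..e.+1} => a j != 0%N) (msupp P)).
  have [Q PE] := mpoly_div_var Pj.
  have Qsupp a : a \in msupp Q -> (U_(j) + a)%MM \in msupp P.
    by move=> aQ; rewrite PE (perm_mem (msuppMX _ _)) map_f.
  have Q0 : Q != 0 by apply: contraNneq P0 => Q0; rewrite PE Q0 mul0r.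
  have QT : Q \is T.-homog.
    apply/dhomogP => a /Qsupp aP; have /dhomogP/(_ _ aP) := PT.
    by rewrite /= mdegD mdeg1 add1n => -[].
  rewrite PE rmorphM /= comp_mpolyXU -tnth_nth; apply: irreducible_vanishingM.
  - by case: (Zirr k ke).
  - exact: comp_multihomogeneous QT.
  - by apply/multihomogeneousP; exists D.
  - apply: IHT => // a i aQ ki; have := Pk _ i (Qsupp _ aQ) ki.
    by rewrite mnmDE => /eqP; rewrite addn_eq0 => /andP[_ /eqP].
  - exact: (FZ' j).
rewrite negbK => /eqP aj.
have [Q [Q0 suppQ PQ]] := mpoly_at_var0 aP aj.
have QP b : b \in msupp Q -> b \in msupp P /\ b j = 0%N.
  by move/suppQ; rewrite mem_filter => /andP[/eqP].
have QT : Q \is T.+1.-homog.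
  by apply/dhomogP => b /QP[bP _]; have /dhomogP/(_ b bP) := PT.
have [|x Zx Qx] := IHk T.+1 Q (ltnW ke) Q0 QT.
  move=> b i /QP[bP bj]; rewrite leq_eqVlt => /predU1P[ki|ki]; last exact: Pk bP ki.
  by rewrite -bj; congr (b _); apply: val_inj.
case: k => [|k] in IHk ke IHT j aj Pk Q suppQ PQ Q0 QT QP Zx Qx *.
  have /dhomogP/(_ a aP) /= := PT; rewrite mdegE big1 // => i _.
  have [->|i0] := eqVneq i j; first exact: aj.
  apply: Pk aP _; rewrite lt0n; apply: contra_neq i0 => i0.
  by apply: val_inj; rewrite /= i0.
exists x.
  by apply: (chain_mono Zchain (k := k)) Zx; rewrite leqnSn.
have [v vx] := mspace_rep x.
have Fjv : mpeval (tnth F j) v = 0.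
  by apply: (FZ (k := j) (l := k)) vx.
move/(vanishes_atE (comp_multihomogeneous PT) vx); rewrite mpeval_comp PQ //.
rewrite -mpeval_comp => Qv; apply: Qx.
by apply/(vanishes_atE (comp_multihomogeneous QT) vx).
Qed.

End ChainIndependence.

(** * Algebraic dependence of polynomials by counting *)

Lemma polynomial_growth r e c : (r < e)%N ->
  exists t, ((e * t * c).+1 ^ r < t.+1 ^ e)%N.
Proof.
move=> re; exists ((e * c).+1 ^ r)%N; set t := ((e * c).+1 ^ r)%N.
apply: (@leq_ltn_trans ((e * c).+1 ^ r * t.+1 ^ r)%N).
  rewrite -expnMn; case: (posnP r) => [->//|r0].
  rewrite leq_exp2r // mulSn addSn ltnS mulnAC (leq_trans _ (leq_addl _ _)) //.
  by rewrite leq_mul2l leqnSn orbT.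
apply: (@leq_trans (t.+1 ^ r.+1)%N); last by rewrite leq_pexp2l.
by rewrite expnS ltn_mul2r expn_gt0 /= ltnS leqnn.
Qed.

Section Dependence.
Variables (K : fieldType) (r : nat).

Definition degree_le c (f : {mpoly K[r]}) := {in msupp f, forall a, (mdeg a <= c)%N}.

Lemma degree_leM c d f g : degree_le c f -> degree_le d g ->
  degree_le (c + d) (f * g).
Proof.
move=> fc gd a /msuppM_le/allpairsP[[a1 a2] /= [a1f a2g ->]].
by rewrite mdegD leq_add ?fc ?gd.
Qed.

Lemma degree_le1 : degree_le 0 1.
Proof. by move=> a; rewrite msupp1 inE => /eqP->; rewrite mdeg0. Qed.

Lemma degree_leX c f k : degree_le c f -> degree_le (c * k) (f ^+ k).
Proof.
move=> fc; elim: k => [|k IH]; first by rewrite muln0; apply: degree_le1.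
by rewrite exprS mulnS; apply: degree_leM.
Qed.

(** There are [t.+1 ^ e] monomials of degree [e * t] in the [F k] whose exponents
    outside the index 0 are at most [t], and their values lie in a space of
    dimension [(e * t * c).+1 ^ r], where [c] bounds the degrees of the [F k].
    For [r < e] and [t] large these values are linearly dependent. *)
Lemma homogeneous_dependence e (F : e.+1.-tuple {mpoly K[r]}) : (r < e)%N ->
  exists T (P : {mpoly K[e.+1]}), [/\ P != 0, P \is T.-homog & P \mPo F = 0].
Proof.
move=> re.
pose c := (\max_k msize (tnth F k))%N.
have Fc k : degree_le c (tnth F k).
  move=> a /msize_mdeg_lt/ltnW/leq_trans; apply; exact: leq_bigmax.
have [t lt_t] := polynomial_growth c re.
pose T := (e * t)%N.
(* The exponent at index 0 makes the monomial homogeneous of degree T. *)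
pose expo (u : {ffun 'I_e -> 'I_t.+1}) : 'X_{1..e.+1} :=
  [multinom if unlift ord0 k is Some l then u l : nat else (T - \sum_l u l)%N | k < e.+1].
have expo0 u : expo u ord0 = (T - \sum_l u l)%N.
  by rewrite multinomE tnth_mktuple unlift_none.
have expoS u l : expo u (lift ord0 l) = u l.
  by rewrite multinomE tnth_mktuple liftK.
have expo_deg u : mdeg (expo u) = T.
  rewrite mdegE big_ord_recl expo0.
  rewrite (eq_bigr _ (fun l _ => expoS u l)).
  apply: subnK; apply: leq_trans (_ : \sum_(l < e) t <= _)%N.
    by apply: leq_sum => l _; rewrite -ltnS.
  by rewrite sum_nat_const card_ord.
have expo_inj : injective expo.
  move=> u w /mnmP eq_uw; apply/ffunP => l; apply: val_inj.
  by have := eq_uw (lift ord0 l); rewrite !expoS.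
pose mono u := 'X_[expo u] \mPo F.
have mono_deg u : degree_le (T * c) (mono u).
  rewrite /mono comp_mpolyX -(expo_deg u) mdegE big_distrl /=.
  elim/big_rec2: _ => [|k d g _ gd]; first exact: degree_le1.
  by rewrite mulnC; apply: degree_leM => //; apply: degree_leX.
pose box (b : {ffun 'I_r -> 'I_(T * c).+1}) : 'X_{1..r} := [multinom b l : nat | l < r].
pose A := \matrix_(u < #|{ffun 'I_e -> 'I_t.+1}|, b < #|{ffun 'I_r -> 'I_(T * c).+1}|)
  (mono (enum_val u))@_(box (enum_val b)).
have : kermx A != 0.
  rewrite -mxrank_eq0 mxrank_ker subn_eq0 -ltnNge.
  by apply: leq_ltn_trans (rank_leq_col A) _; rewrite !card_ffun !card_ord.
case/matrix0Pn=> s [u0 su0].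
pose P := \sum_u kermx A s u *: 'X_[expo (enum_val u)] : {mpoly K[e.+1]}.
exists T, P; split.
- apply: contraNneq su0 => P0.
  have <- : P@_(expo (enum_val u0)) = kermx A s u0; last by rewrite P0 mcoeff0.
  rewrite /P raddf_sum (bigD1 u0) //= mcoeffZ mcoeffX eqxx mulr1 big1 ?addr0 //.
  move=> u uu0; rewrite mcoeffZ mcoeffX (inj_eq expo_inj) (inj_eq enum_val_inj).
  by rewrite (negPf uu0) mulr0.
- by apply: rpred_sum => u _; apply: rpredZ; rewrite dhomogX /= expo_deg.
have -> : P \mPo F = \sum_u kermx A s u *: mono (enum_val u).
  by rewrite (raddf_sum (comp_mpoly F)); apply: eq_bigr => u _; apply: comp_mpolyZ.
apply/mpolyP => a; rewrite mcoeff0 (raddf_sum (mcoeff a)) /=.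
under eq_bigr => u _ do rewrite mcoeffZ.
have [aT|aT] := boolP [forall l, a l < (T * c).+1]%N.
  pose b : {ffun 'I_r -> 'I_(T * c).+1} := [ffun l => inord (a l)].
  have /matrixP/(_ s (enum_rank b)) := mulmx_ker A; rewrite [LHS]mxE [RHS]mxE => eqA.
  rewrite -[RHS]eqA.
  apply: eq_bigr => u _; congr (_ * _); rewrite mxE enum_rankK; congr (mcoeff _ _).
  by apply/mnmP => l; rewrite multinomE tnth_mktuple ffunE inordK // (forallP aT).
rewrite big1 // => u _; rewrite memN_msupp_eq0 ?mulr0 //.
apply: contra aT => /mono_deg aT; apply/forallP => l; rewrite ltnS.
by apply: leq_trans aT; rewrite mdegE (bigD1 l) //= leq_addr.
Qed.

End Dependence.

(** * Upper bounds for chains in a parametrized variety *)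

Section JointImage.
Variables (K : fieldType) (N h n : nat).

Lemma centerE (C : 'M[K]_(h.+1, N.+1)) (X : pspace K N) v :
  val X = <[v]>%VS -> center C X <-> C *m v = 0.
Proof.
rewrite /center /= => ->; rewrite -memvE memv_ker lfunE /=.
by split=> [/eqP|->].
Qed.

Lemma joint_imageP (C : 'I_n -> 'M[K]_(h.+1, N.+1)) x :
  (0 < n)%N ->
  joint_image C x <->
  exists2 v, (forall i, C i *m v != 0) & represents (fun i => C i *m v) x.
Proof.
move=> n0; split=> [[X Xx]|[v Cv vx]].
  have [v _ Xv] := pspace_rep X.
  exists v => i; have [XC xi] := Xx i.
    by apply/eqP => /(centerE _ Xv).
  by rewrite xi Xv limg_line lfunE.
have v0 : v != 0.
  by apply: contraNneq (Cv (Ordinal n0)) => ->; rewrite mulmx0.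
have [X Xv] := pspace_of v0; exists X => i; split.
  by move/(centerE _ Xv)/eqP; apply/negP.
by rewrite Xv limg_line lfunE /= vx.
Qed.

End JointImage.

Section ParametricBound.
Variables (K : fieldType) (n h r : nat).
Variable phi : 'I_n -> 'I_h.+1 -> {mpoly K[r]}.

(** The hypothesis expresses that the points with coordinates [phi] are dense in
    [A], without requiring that every point of [A] be one of them. *)
Lemma chain_length_le (A : set (mspace K n h)) e Z :
  (forall f d, has_multidegree d f ->
     (forall u, mpeval f (fun i => \col_j (phi i j).@[u]) = 0) ->
     A `<=` [set x | vanishes_at f x]) ->
  irreducible_chain (zariski_closure A) e Z -> (e <= r)%N.
Proof.
move=> phiA Zchain; rewrite leqNgt; apply/negP => re.
have [D [F [FD FZ FZ']]] := chain_forms Zchain.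
pose Phi := [tuple mxvec (\matrix_(i < n, j < h.+1) phi i j) 0 k | k < n * h.+1].
have PhiE f u : (f \mPo Phi).@[u] = mpeval f (fun i => \col_j (phi i j).@[u]).
  rewrite comp_mpoly_meval /mpeval; apply: meval_eq => k.
  by case/mxvec_indexP: k => i j; rewrite tnth_mktuple !mxvecE !mxE.
have [T [P [P0 PT PF]]] :=
  homogeneous_dependence [tuple tnth F k \mPo Phi | k < e.+1] re.
have fT := has_multidegree_comp FD PT.
have [|x Zx nfx] := chain_independence Zchain FD FZ FZ' (leqnn e.+1) P0 PT.
  by move=> a i _; rewrite leqNgt ltn_ord.
have [_ /(_ _ Zx) Ax] := Zchain.1 e (leqnn e).
have fh : multihomogeneous (P \mPo F).
  by apply/multihomogeneousP; exists (fun i => D i * T)%N.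
apply: nfx; apply: (zariski_closure_sub (closed_vanishing fh) _ Ax).
apply: phiA fT _ => u; rewrite mpeval_comp.
transitivity (P \mPo [tuple tnth F k \mPo Phi | k < e.+1]).@[u]; last by rewrite PF meval0.
by rewrite comp_mpoly_meval; apply: meval_eq => k; rewrite tnth_mktuple PhiE.
Qed.

End ParametricBound.

Section FactoredBound.
Variables (K : numFieldType) (N h n G s : nat).
Variables (C : 'I_n -> 'M[K]_(h.+1, N.+1)) (g : 'I_n -> 'I_G).
Variables (B : 'I_G -> 'M[K]_(s.+1, N.+1)) (A : 'I_n -> 'M[K]_(h.+1, s.+1)).

(** The parameters are the coordinates of [G] vectors of [K^(s+1)], each
    normalized by its first coordinate being 1. Multihomogeneity extends the
    vanishing of a form from the normalized vectors to those with nonzero first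
    coordinates, and restricting the form to a line in the direction [e0]
    extends it to the remaining ones. *)
Lemma factored_chain_length e Z : (0 < n)%N ->
  (forall i, C i = A i *m B (g i)) ->
  irreducible_chain (multiview_variety C) e Z -> (e <= G * s)%N.
Proof.
move=> n0 CE; pose phi i j : {mpoly K[G * s]} := (A i j 0)%:MP +
  \sum_l A i j (lift ord0 l) *: 'X_(mxvec_index (g i) l).
apply: (chain_length_le (phi := phi)) => f d fd f0 x /(joint_imageP _ _ n0)[v _ vx].
have fh : multihomogeneous f by apply/multihomogeneousP; exists d.
apply/(vanishes_atE fh vx).
have affine (w : 'I_G -> 'cV[K]_s.+1) : (forall k, w k 0 0 = 1) ->
    mpeval f (fun i => A i *m w (g i)) = 0.
  move=> w1; pose u k := mxvec (\matrix_(a < G, l < s) w a (lift ord0 l) 0) 0 k.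
  rewrite -(f0 u); congr mpeval; apply: funext => i; apply/matrixP => j z.
  rewrite ord1 !mxE big_ord_recl w1 mulr1 mevalD mevalC (raddf_sum (meval u)); congr (_ + _).
  by apply: eq_bigr => l _; rewrite /= mevalZ mevalXU /u mxvecE mxE.
have cone (w : 'I_G -> 'cV[K]_s.+1) : (forall k, w k 0 0 != 0) ->
    mpeval f (fun i => A i *m w (g i)) = 0.
  move=> w0; pose w' k := (w k 0 0)^-1 *: w k.
  have -> : (fun i => A i *m w (g i)) = (fun i => w (g i) 0 0 *: (A i *m w' (g i))).
    by apply: funext => i; rewrite scalemxAr /w' scalerA mulfV ?scale1r.
  rewrite (mpeval_scale _ _ fd) affine ?mulr0 // => k.
  by rewrite mxE mulVf.
pose w k := B k *m v; pose e0 : 'cV[K]_s.+1 := delta_mx 0 0.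
have [p pE] := mpeval_line f (fun i => C i *m v) (fun i => A i *m e0).
suff p0 : p = 0.
  have := pE 0; rewrite p0 horner0 => ->; congr mpeval.
  by apply: funext => i; rewrite scale0r addr0.
(* Off the roots of the product all first coordinates are nonzero. *)
have qp0 : \prod_k ('X + (w k 0 0)%:P) * p = 0.
  apply: poly_eq0_from_values => t; rewrite hornerM pE horner_prod.
  have [->|wk] := eqVneq (\prod_k ('X + (w k 0 0)%:P).[t]) 0; first by rewrite mul0r.
  rewrite -[X in _ * X](_ : 0 = _) ?mulr0 //.
  rewrite -(cone (fun k => w k + t *: e0)).
    by congr mpeval; apply: funext => i; rewrite CE mulmxDr scalemxAr mulmxA.
  move=> k; move/prodf_neq0: wk => /(_ k isT).
  by rewrite !hornerE !mxE eqxx mulr1 addrC.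
move/eqP: qp0; rewrite mulf_eq0 => /orP[/prodf_eq0[k _]|/eqP//].
by rewrite -size_poly_eq0 size_XaddC.
Qed.

End FactoredBound.

(** * Chains cut out by flags *)

Section LinearImages.
Variables (K : numFieldType) (N h n : nat).
Variable C : 'I_n -> 'M[K]_(h.+1, N.+1).

Definition image_of (W : set 'cV[K]_N.+1) : set (mspace K n h) :=
  [set x | exists v, [/\ W v, forall i, C i *m v != 0 &
                         represents (fun i => C i *m v) x]].

(** If the image lies in the union of two closed sets and in neither of them,
    take one form from each, with a point of [W] where it does not vanish. On
    the line through the two points both forms restrict to nonzero
    polynomials, so at a generic point of it neither vanishes. *)
Lemma irreducible_image (W : set 'cV[K]_N.+1) v0 :
  (forall v w t, W v -> W w -> W (v + t *: (w - v))) ->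
  W v0 -> (forall i, C i *m v0 != 0) ->
  irreducible_closed (zariski_closure (image_of W)).
Proof.
move=> Wline Wv0 Cv0; have Wimage v : W v -> (forall i, C i *m v != 0) ->
    exists2 x, image_of W x & represents (fun i => C i *m v) x.
  by move=> Wv Cv; have [x vx] := mspace_of Cv; exists x => //; exists v.
split; first exact: closed_zariski_closure.
  by have [x Wx _] := Wimage v0 Wv0 Cv0; exists x; apply: sub_zariski_closure.
have separate S : S `<=` @multihomogeneous K n h ->
    ~ zariski_closure (image_of W) `<=` [set x | forall f, S f -> vanishes_at f x] ->
    exists f v, [/\ S f, W v, forall i, C i *m v != 0 & mpeval f (fun i => C i *m v) != 0].
  move=> Sh; apply: contra_notP => no.
  apply: zariski_closure_sub; first by exists S.
  move=> x [v [Wv Cv vx]] f Sf; apply/(vanishes_atE (Sh f Sf) vx)/eqP.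
  by apply: contraPT no => fv; apply; exists f, v.
move=> _ _ [SA SAh ->] [SB SBh ->] ZAB; apply: contrapT => /not_orP[ZA ZB].
have [f [v [SAf Wv Cv fv]]] := separate SA SAh ZA.
have [f' [w [SBf' Ww Cw f'w]]] := separate SB SBh ZB.
pose l t := v + t *: (w - v).
have lE i t : C i *m l t = C i *m v + t *: (C i *m (w - v)).
  by rewrite mulmxDr scalemxAr.
have [p pE] := mpeval_line f (fun i => C i *m v) (fun i => C i *m (w - v)).
have [p' p'E] := mpeval_line f' (fun i => C i *m v) (fun i => C i *m (w - v)).
have p0 : p != 0.
  apply: contraNneq fv => p0; have := pE 0; rewrite p0 horner0 => ->.
  by apply/eqP; congr mpeval; apply: funext => i; rewrite scale0r addr0.
have p'0 : p' != 0.
  apply: contraNneq f'w => p'0; have := p'E 1; rewrite p'0 horner0 => ->.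
  by apply/eqP; congr mpeval; apply: funext => i; rewrite scale1r -mulmxDr addrC subrK.
have gC : generic (fun t => forall i, C i *m v + t *: (C i *m (w - v)) != 0).
  by apply: generic_forall => i; apply: generic_line_neq0; rewrite Cv.
have [t [[pt p't] Ct]] :=
  generic_ex (genericI (genericI (generic_nonroot p0) (generic_nonroot p'0)) gC).
have Clt i : C i *m l t != 0 by rewrite lE.
have [x Wx lx] := Wimage (l t) (Wline _ _ _ Wv Ww) Clt.
have El : (fun i => C i *m v + t *: (C i *m (w - v))) = (fun i => C i *m l t).
  by apply: funext => i; rewrite lE.
have [/(_ f SAf)|/(_ f' SBf')] := ZAB x (sub_zariski_closure Wx).
  by move/(vanishes_atE (SAh _ SAf) lx)/eqP; rewrite -El -pE (negPf pt).
by move/(vanishes_atE (SBh _ SBf') lx)/eqP; rewrite -El -p'E (negPf p't).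
Qed.

(** The member [k] of the chain is the closure of the image of the common kernel
    of the rows of [M] of index at least [k]. *)
Lemma chain_from_flag (idx : 'I_N -> 'I_n) (rho : 'I_N -> 'rV[K]_h.+1)
    (M : 'M[K]_(N, N.+1)) (v0 : 'cV[K]_N.+1) :
  (0 < n)%N ->
  (forall s, row s M = rho s *m C (idx s)) -> row_free M -> M *m v0 = 0 ->
  (forall i, C i *m v0 != 0) ->
  exists Z, irreducible_chain (multiview_variety C) N Z.
Proof.
move=> n0 ME Mfree Mv0 Cv0.
pose W k : set 'cV[K]_N.+1 := [set v | forall s : 'I_N, (k <= s)%N -> row s M *m v = 0].
have Wmono k : W k `<=` W k.+1 by move=> v Wv s /ltnW; apply: Wv.
have Wv0 k : W k v0 by move=> s _; rewrite -row_mul Mv0 row0.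
have Wline k v w t : W k v -> W k w -> W k (v + t *: (w - v)).
  move=> Wv Ww s ks.
  by rewrite mulmxDr -scalemxAr mulmxBr Wv ?Ww ?subrr ?scaler0 ?addr0.
have image_mono (W1 W2 : set 'cV[K]_N.+1) : W1 `<=` W2 ->
    zariski_closure (image_of W1) `<=` zariski_closure (image_of W2).
  move=> W12; apply: zariski_closure_sub; first exact: closed_zariski_closure.
  move=> x [v [Wv Cv vx]]; apply: sub_zariski_closure.
  by exists v; split=> //; apply: W12.
exists (fun k => zariski_closure (image_of (W k))); split=> k kN.
  split; first exact: irreducible_image (Wline k) (Wv0 k) Cv0.
  apply: zariski_closure_sub; first exact: closed_zariski_closure.
  move=> x [v [_ Cv vx]]; apply: sub_zariski_closure.
  by apply/joint_imageP => //; exists v.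
split; first by apply: image_mono; apply: Wmono.
pose s := Ordinal kN.
pose f : {mpoly K[n * h.+1]} := \sum_j rho s 0 j *: 'X_(mxvec_index (idx s) j).
have fh : multihomogeneous f.
  apply/multihomogeneousP; exists (fun i => (i == idx s) : nat) => i.
  apply: rpred_sum => j _; apply: rpredZ.
  exact: (@has_multidegree_var K n h (idx s) j i).
have fE v : mpeval f (fun i => C i *m v) = (row s M *m v) 0 0.
  rewrite ME -mulmxA mxE /mpeval /f (raddf_sum (meval _)); apply: eq_bigr => j _.
  by rewrite /= mevalZ -/(mpeval _ _) mpeval_var.
(* The s-th vector of a family dual to the rows of M, which lies in [W k.+1] but
   not in [W k]. *)
pose y := col s (pinvmx M).
have My (r : 'I_N) : row r M *m y = (r == s)%:R%:M.
  rewrite -row_mul /y colE mulmxA mulmxVp // mul1mx.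
  by apply/matrixP => a b; rewrite !ord1 !mxE eqxx andbT mulr1n.
have Wy v t : W k v -> W k.+1 (v + t *: y).
  move=> Wv r kr; rewrite mulmxDr Wv ?(ltnW kr) // -scalemxAr My.
  by rewrite -val_eqE /= gtn_eqF // raddf0 scaler0 addr0.
have [t [t0 Ct]] : exists t, t != 0 /\ forall i, C i *m (v0 + t *: y) != 0.
  have gX : generic (fun t : K => t != 0).
    by exists 'X => [|t]; rewrite ?polyX_eq0 ?hornerX.
  apply/generic_ex/(genericI gX)/generic_forall => i.
  have := @generic_line_neq0 K _ _ (C i *m v0) (C i *m y).
  rewrite Cv0 => /(_ isT); apply: generic_weaken => t.
  by rewrite mulmxDr scalemxAr.
move=> sub; have [x vx] := mspace_of Ct.
have Zx : zariski_closure (image_of (W k.+1)) x.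
  by apply: sub_zariski_closure; exists (v0 + t *: y); split=> //; apply: Wy.
have fx : vanishes_at f x.
  apply: (zariski_closure_sub (closed_vanishing fh)) (sub _ Zx).
  move=> z [v [Wv Cv vz]]; apply/(vanishes_atE fh vz).
  by rewrite fE Wv // mxE.
move/(vanishes_atE fh vx)/eqP: fx; apply/negP.
by rewrite fE mulmxDr (Wv0 k) // -scalemxAr My eqxx add0r !mxE eqxx mulr1n mulr1.
Qed.

End LinearImages.

(** * From rank conditions on the cameras to chains *)

Section KernelVectors.
Variables (K : fieldType) (N : nat).

Lemma common_kernel_vector p (S : 'M[K]_(p, N.+1)) : (\rank S <= N)%N ->
  exists2 v : 'cV[K]_N.+1, v != 0 &
    forall m (A : 'M[K]_(m, N.+1)), (A <= S)%MS -> A *m v = 0.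
Proof.
move=> rkS; have : cokermx S != 0.
  by rewrite -mxrank_eq0 mxrank_coker subn_eq0 -ltnNge.
case/matrix0Pn=> a [b Sab]; exists (col b (cokermx S)).
  by apply: contra_neq Sab => /matrixP/(_ a 0); rewrite !mxE.
move=> m A /submxP[D ->].
by rewrite colE mulmxA -[D *m S *m _]mulmxA mulmx_coker mulmx0 mul0mx.
Qed.

Lemma rank_le_of_kernel_vector p (S : 'M[K]_(p, N.+1)) (v : 'cV[K]_N.+1) :
  v != 0 -> S *m v = 0 -> (\rank S <= N)%N.
Proof.
move=> v0 Sv; rewrite -ltnS ltn_neqAle rank_leq_col andbT.
apply: contra v0 => /row_fullP[B BS].
by rewrite -[v]mul1mx -BS -mulmxA Sv mulmx0.
Qed.

End KernelVectors.

Section FlagFromCameras.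
Variables (K : numFieldType) (N h n : nat).
Variables (C : 'I_n -> 'M[K]_(h.+1, N.+1)) (idx : 'I_N -> 'I_n).

Let rows (R : 'M[K]_(N, h.+1)) : 'M[K]_(N, N.+1) :=
  \matrix_s (row s R *m C (idx s)).

Let frame j (sigma : 'rV[K]_h.+1) R : 'M[K]_(1 + N) := col_mx (sigma *m C j) (rows R).

(** A nonzero determinant for some [sigma] says that the forms [rows R] are
    independent and that their common zero is off the center of [C j]. Such determinants are polynomials on the line through two
    choices of [R], so a choice good for some cameras and one good for another
    camera give a choice good for all of them. *)
Lemma common_flag :
  (forall j, exists R sigma, \det (frame j sigma R) != 0) ->
  exists R, forall j, exists sigma, \det (frame j sigma R) != 0.
Proof.
move=> good; suff [R Rgood] : exists R, {in enum 'I_n, forall j, exists sigma,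
    \det (frame j sigma R) != 0}.
  by exists R => j; apply: Rgood; rewrite mem_enum.
elim: (enum 'I_n) => [|j s [R Rs]]; first by exists 0.
have [R' [sigma' R'j]] := good j.
have lineE k sigma t : frame k sigma (R + t *: (R' - R)) =
    frame k sigma R + t *: col_mx 0 (rows (R' - R)).
  rewrite scale_col_mx add_col_mx scaler0 addr0; congr col_mx.
  apply/matrixP => a b; rewrite !mxE big_distrr -big_split; apply: eq_bigr => c _.
  by rewrite !mxE /= mulrDl mulrA.
pose reaches k t := exists sigma, \det (frame k sigma (R + t *: (R' - R))) != 0.
have generic_reaches k t : reaches k t -> generic (reaches k).
  move=> [sigma dt].
  have [p pE] := det_line (frame k sigma R) (col_mx 0 (rows (R' - R))).
  exists p; last by move=> u pu; exists sigma; rewrite lineE -pE.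
  by apply: contraNneq dt => p0; rewrite lineE -pE p0 horner0.
have [t gt] : exists t, {in j :: s, forall k, reaches k t}.
  apply/generic_ex/generic_all => k; rewrite inE => /predU1P[->|/Rs[sigma ks]].
    by apply: (generic_reaches _ 1); exists sigma'; rewrite scale1r addrC subrK.
  by apply: (generic_reaches _ 0); exists sigma; rewrite scale0r addr0.
by exists (R + t *: (R' - R)).
Qed.

Lemma chain_from_frames : (0 < n)%N ->
  (forall j, exists R sigma, \det (frame j sigma R) != 0) ->
  exists Z, irreducible_chain (multiview_variety C) N Z.
Proof.
move=> n0 /common_flag[R Rgood]; pose M := rows R.
have Mfree : row_free M.
  have [sigma] := Rgood (Ordinal n0).
  rewrite -unitfE -unitmxE -row_free_unit /row_free -addsmxE => /eqP rkM.
  rewrite /row_free eqn_leq rank_leq_row -(leq_add2l 1) -{1}rkM.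
  by apply: leq_trans (mxrank_adds_leqif _ _) _; rewrite leq_add2r rank_leq_row.
have [v v0 Mv] := common_kernel_vector (rank_leq_row M).
apply: (@chain_from_flag _ _ _ _ C idx (fun s => row s R) M v) => //.
- by move=> s; rewrite rowK.
- exact: Mv.
move=> j; have [sigma dj] := Rgood j; apply: contra_neq v0 => Cv.
have fU : frame j sigma R \in unitmx by rewrite unitmxE unitfE.
have : frame j sigma R *m v = 0.
  by rewrite mul_col_mx -mulmxA Cv mulmx0 Mv // col_mx0.
by move/(congr1 (mulmx (invmx (frame j sigma R)))); rewrite mulKmx // mulmx0.
Qed.

Definition camera_or j (a : option 'I_N) := if a is Some s then idx s else j.

(** Rado's condition for the row spaces of the cameras [idx s], to which the row
    space of the camera [j] is added under the index [None]. *)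
Lemma chain_from_rank_condition : (0 < n)%N ->
  (forall j (J : {set option 'I_N}),
     #|J| <= \rank (\sum_(a in J) <<C (camera_or j a)>>)%MS)%N ->
  exists Z, irreducible_chain (multiview_variety C) N Z.
Proof.
move=> n0 rado; apply: chain_from_frames => // j.
pose U a := <<C (camera_or j a)>>%MS.
have [|x [xU rkx]] := @independent_transversal K _ N.+1 U [set: option 'I_N]%SET 0.
  by move=> J _; rewrite mxrank0 add0n adds0mx; apply: rado.
have /choice[rho xE] : forall a, exists rho : 'rV_h.+1, x a = rho *m C (camera_or j a).
  by move=> a; apply/submxP; rewrite -(genmxE (C _)); apply: xU; rewrite inE.
exists (\matrix_s rho (Some s)), (rho None); set F := frame _ _ _.
have xF : (\sum_(a in [set: option 'I_N]%SET) <<x a>> <= F)%MS.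
  apply/sumsmx_subP => -[s|] _; rewrite genmxE xE /F /frame -addsmxE.
    have -> : rho (Some s) *m C (camera_or j (Some s)) =
        row s (rows (\matrix_s rho (Some s))) by rewrite !rowK.
    by apply: submx_trans (addsmxSr _ _); apply: row_sub.
  exact: addsmxSl.
move: rkx; rewrite mxrank0 adds0mx add0n cardsT card_option card_ord.
move/leq_trans/(_ (mxrankS xF)) => rkF.
by rewrite -unitfE -unitmxE -row_free_unit /row_free eqn_leq rank_leq_row.
Qed.

End FlagFromCameras.

(** * Centers and row spaces *)

Section Centers.
Variables (K : fieldType) (N h : nat).
Implicit Types A B : 'M[K]_(h.+1, N.+1).

Lemma submx_of_center A B : center A `<=` center B -> (B <= A)%MS.
Proof.
move=> AB; rewrite submxE; apply/eqP/trmx_inj/row_matrixP => b; rewrite -tr_col trmx0 row0.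
rewrite colE -mulmxA -colE; set v := col b _.
suff -> : B *m v = 0 by rewrite trmx0.
have [->|v0] := eqVneq v 0; first by rewrite mulmx0.
have [X Xv] := pspace_of v0; apply/(centerE _ Xv)/AB/(centerE _ Xv).
by rewrite /v colE mulmxA mulmx_coker mul0mx.
Qed.

Lemma center_of_submx A B : (B <= A)%MS -> center A `<=` center B.
Proof.
case/submxP=> D -> X; have [v _ Xv] := pspace_rep X.
by move/(centerE _ Xv) => Av; apply/(centerE _ Xv); rewrite -mulmxA Av mulmx0.
Qed.

Lemma eq_center_of_rank A B : \rank A = h.+1 -> \rank B = h.+1 ->
  (\rank (A + B)%MS <= h.+1)%N -> center A = center B.
Proof.
move=> rA rB rAB; have AB : (B <= A)%MS /\ (A <= B)%MS.
  have [_ eA] := mxrank_leqif_sup (addsmxSl A B).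
  have [_ eB] := mxrank_leqif_sup (addsmxSr A B).
  have rE : \rank (A + B)%MS = h.+1.
    by apply/eqP; rewrite eqn_leq rAB -{1}rA mxrankS ?addsmxSl.
  move: eA eB; rewrite rA rB rE eqxx => /esym eA /esym eB.
  by rewrite (submx_trans (addsmxSr A B) eA) (submx_trans (addsmxSl A B) eB).
by apply/seteqP; split; apply: center_of_submx; case: AB.
Qed.

Lemma disjoint_centers_rank A B : center A `&` center B = set0 ->
  (N < \rank (A + B)%MS)%N.
Proof.
move=> disj; rewrite ltnNge; apply/negP => /common_kernel_vector[v v0 Sv].
have [X Xv] := pspace_of v0; have : set0 X by rewrite -disj; split;
  apply/(centerE _ Xv)/Sv; rewrite ?addsmxSl ?addsmxSr.
by [].
Qed.

End Centers.

(** * Upper bounds for the degenerate arrangements *)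

Section Cases.
Variables (K : numFieldType) (N h n : nat).
Variable C : 'I_n -> 'M[K]_(h.+1, N.+1).
Hypotheses (n_gt0 : (0 < n)%N) (rkC : forall i, \rank (C i) = h.+1).

Lemma chain_length_le_ambient e Z :
  irreducible_chain (multiview_variety C) e Z -> (e <= N)%N.
Proof.
rewrite -{2}[N]mul1n; apply: (factored_chain_length (G := 1) (s := N)
  (g := fun=> 0) (B := fun=> 1%:M) (A := C)) => // i.
by rewrite mulmx1.
Qed.

(** All the cameras factor through the projection from the common point. *)
Lemma concurrent_chain_length s e Z : N = s.+1 ->
  concurrent C [set: 'I_n]%SET ->
  irreducible_chain (multiview_variety C) e Z -> (e <= s)%N.
Proof.
move=> Ns [X XC] Zch; have [v v0 Xv] := pspace_rep X.
have Cv i : C i *m v = 0 by apply/(centerE _ Xv)/XC; rewrite inE.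
have rkv : \rank (kermx v) = s.+1.
  rewrite mxrank_ker -Ns.
  suff -> : \rank v = 1%N by rewrite subn1.
  by apply/eqP; rewrite eqn_leq rank_leq_col lt0n mxrank_eq0.
have [B vB] : exists B : 'M[K]_(s.+1, N.+1), (kermx v <= B)%MS.
  by rewrite -rkv; exists (row_base (kermx v)); rewrite eq_row_base.
have /choice[A AE] : forall i, exists A, C i = A *m B.
  by move=> i; apply/submxP; apply: submx_trans vB; apply/sub_kermxP.
rewrite -[s]mul1n; apply: (factored_chain_length (G := 1)
  (g := fun=> 0) (B := fun=> B) (A := A)) Zch => // i.
Qed.

Lemma two_centers_chain_length e Z i1 i2 :
  (forall i, center (C i) = center (C i1) \/ center (C i) = center (C i2)) ->
  irreducible_chain (multiview_variety C) e Z -> (e <= 2 * h)%N.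
Proof.
move=> C12 Zch; pose B (b : 'I_2) := C (if b == 0 then i1 else i2).
have /choice[gA gAE] : forall i, exists gA : 'I_2 * 'M[K]_h.+1, C i = gA.2 *m B gA.1.
  move=> i; case: (C12 i) => Ci.
    have /submxP[A AE] : (C i <= C i1)%MS by apply: submx_of_center; rewrite Ci.
    by exists (0, A).
  have /submxP[A AE] : (C i <= C i2)%MS by apply: submx_of_center; rewrite Ci.
  by exists (1, A).
exact: (factored_chain_length (g := fun i => (gA i).1) (B := B)
  (A := fun i => (gA i).2)) Zch.
Qed.

Lemma meeting_centers_chain_length e Z : N = h.+1 ->
  (forall i j, center (C i) `&` center (C j) !=set0) ->
  irreducible_chain (multiview_variety C) e Z -> (e <= h)%N.
Proof.
move=> Nh meet; apply: concurrent_chain_length => //.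
pose i0 := Ordinal n_gt0; have [X [X0 _]] := meet i0 i0.
exists X => i _; suff -> : center (C i) = center (C i0) by [].
apply: eq_center_of_rank; rewrite ?rkC // -[X in (_ <= X)%N]Nh.
have [Y [Yi Y0]] := meet i i0; have [v v0 Yv] := pspace_rep Y.
apply: (rank_le_of_kernel_vector v0).
have /submxP[D ->] : (C i + C i0 <= col_mx (C i) (C i0))%MS by rewrite addsmxE.
by rewrite -mulmxA mul_col_mx !((centerE _ Yv).1 _) // col_mx0 mulmx0.
Qed.

Definition first_with_center : {set 'I_n} :=
  [set i : 'I_n | [forall j : 'I_n, (j < i)%N ==> ~~ `[< center (C j) = center (C i) >]]]%SET.

Lemma first_with_center_inj :
  {in first_with_center &, injective (fun i => center (C i))}.
Proof.
move=> i j; rewrite !inE => /forallP iI /forallP jI ij; apply: val_inj.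
case: (ltngtP i j) => // [lt|lt].
  by have := jI i; rewrite lt => /asboolP; rewrite ij.
by have := iI j; rewrite lt => /asboolP; rewrite ij.
Qed.

Lemma first_with_centerP i :
  exists2 j, j \in first_with_center & center (C j) = center (C i).
Proof.
have Pi : `[< center (C i) = center (C i) >] by apply/asboolP.
case: (@arg_minnP _ i (fun j => `[< center (C j) = center (C i) >])
  (fun j => nat_of_ord j) Pi) => j /asboolP ji jmin.
exists j => //; rewrite inE; apply/forallP => k; apply/implyP => kj.
apply/negP => /asboolP kji; have := jmin k.
by rewrite leqNgt kj => H; apply: notF; apply: H; apply/asboolP; rewrite kji.
Qed.

(** Choose one camera for each center that occurs. If there are at least three of
    them, their centers are concurrent by hypothesis, hence so are all centers;
    otherwise two of them account for every center. *)
Lemma line_centers_chain_length e Z : N = h.+2 -> h = 1%N ->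
  ~ (exists I : {set 'I_n}, [/\ (3 <= #|I|)%N,
       {in I &, injective (fun i => center (C i))} & ~ concurrent C I]) ->
  irreducible_chain (multiview_variety C) e Z -> (e <= 2)%N.
Proof.
move=> Nh h1 no Zch; pose I := first_with_center.
have [I3|I2] := leqP 3 #|I|.
  have [X XI] : concurrent C I.
    by apply: contrapT => nI; apply: no; exists I; split=> //; apply: first_with_center_inj.
  apply: concurrent_chain_length Zch; first by rewrite Nh h1.
  by exists X => i _; have [j jI <-] := first_with_centerP i; apply: XI.
have [i1 [i2 I12]] : exists i1 i2, I \subset [set i1; i2]%SET.
  move: I2; rewrite cardE; have memI i : (i \in I) = (i \in enum I) by rewrite mem_enum.
  case: (enum I) memI => [|a [|b [|//]]] memI _.
  - by exists (Ordinal n_gt0), (Ordinal n_gt0); apply/fintype.subsetP => i; rewrite memI.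
  - by exists a, a; apply/fintype.subsetP => i; rewrite memI !inE orbb.
  - by exists a, b; apply/fintype.subsetP => i; rewrite memI !inE.
rewrite -[2%N](muln1 2) -{2}h1; apply: two_centers_chain_length Zch => i.
have [j jI <-] := first_with_centerP i.
by have := fintype.subsetP I12 j jI; rewrite !inE => /orP[]/eqP->; [left|right].
Qed.

End Cases.

(** * Chains of full length *)

Section FullDimension.
Variables (K : numFieldType) (N h n : nat).
Variable C : 'I_n -> 'M[K]_(h.+1, N.+1).
Hypotheses (n_gt0 : (0 < n)%N) (rkC : forall i, \rank (C i) = h.+1).

Lemma card_option_le (J : {set option 'I_N}) : (#|J| <= N.+1)%N.
Proof. by have := max_card (mem J); rewrite card_option card_ord. Qed.

Lemma rank_sum_cameras_ge (T : finType) (cam : T -> 'I_n) (J : {set T}) a : a \in J ->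
  (h < \rank (\sum_(b in J) <<C (cam b)>>)%MS)%N.
Proof.
move=> aJ; apply: (@leq_trans (\rank (C (cam a)))); first by rewrite rkC.
by apply: mxrankS; rewrite (sumsmx_sup a) ?genmxE.
Qed.

Lemma rank_pair_le_sum (T : finType) (cam : T -> 'I_n) (J : {set T}) a b :
  a \in J -> b \in J ->
  (\rank (C (cam a) + C (cam b))%MS <= \rank (\sum_(c in J) <<C (cam c)>>)%MS)%N.
Proof.
move=> aJ bJ; apply: mxrankS; rewrite addsmx_sub.
by rewrite (sumsmx_sup a) ?genmxE // (sumsmx_sup b) ?genmxE.
Qed.

Lemma chain_of_invertible_cameras : h = N ->
  exists Z, irreducible_chain (multiview_variety C) N Z.
Proof.
move=> hN; apply: (chain_from_rank_condition (idx := fun=> Ordinal n_gt0)) => // j J.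
have [->|[a aJ]] := set_0Vmem J; first by rewrite cards0.
apply: leq_trans (card_option_le J) _; rewrite -[in X in (X <= _)%N]hN.
exact: rank_sum_cameras_ge aJ.
Qed.

(** The row space of each camera is a hyperplane of the dual space, so only the
    full index set needs more than one camera in Rado's condition; it contains
    both an index of [i1] and an index of [i2], whose row spaces together span
    everything. That uses [N >= 2]. *)
Lemma chain_of_disjoint_centers i1 i2 : N = h.+1 -> (0 < h)%N ->
  center (C i1) `&` center (C i2) = set0 ->
  exists Z, irreducible_chain (multiview_variety C) N Z.
Proof.
move=> Nh h0 /disjoint_centers_rank rk12.
have N1 : (1 < N)%N by rewrite Nh.
pose idx (s : 'I_N) := if s == 0%N :> nat then i1 else i2.
apply: (chain_from_rank_condition (idx := idx)) => // j J.
have [->|[a aJ]] := set_0Vmem J; first by rewrite cards0.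
have [JN|NJ] := leqP #|J| N.
  by apply: leq_trans JN _; rewrite [X in (X <= _)%N]Nh; apply: rank_sum_cameras_ge aJ.
have JT b : b \in J.
  suff -> : J = [set: option 'I_N]%SET by rewrite inE.
  by apply/eqP; rewrite eqEcard finset.subsetT cardsT card_option card_ord.
apply: leq_trans (card_option_le J) (leq_trans rk12 _).
exact: (@rank_pair_le_sum _ (camera_or idx j) J
  (Some (Ordinal (ltnW N1))) (Some (Ordinal N1))).
Qed.

End FullDimension.

Section ThreeLines.
Variables (K : numFieldType) (n : nat).
Variable C : 'I_n -> 'M[K]_(2, 4).
Hypotheses (n_gt0 : (0 < n)%N) (rkC : forall i, \rank (C i) = 2%N).

(** Rado's condition by the cardinal of [J]: one camera settles [#|J| <= 2]; three
    indices include two of the three lines, whose row spaces span at least a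
    hyperplane of the dual space; four indices include all three lines. *)
Lemma chain_of_three_lines (idx : 'I_3 -> 'I_n) :
  (forall a b, a != b -> 2 < \rank (C (idx a) + C (idx b))%MS)%N ->
  (3 < \rank (\sum_a <<C (idx a)>>)%MS)%N ->
  exists Z, irreducible_chain (multiview_variety C) 3 Z.
Proof.
move=> rk2 rk3; apply: (chain_from_rank_condition (idx := idx)) => // j J.
have [->|[c cJ]] := set_0Vmem J; first by rewrite cards0.
have [J2|J3] := leqP #|J| 2.
  by apply: leq_trans J2 _; apply: (rank_sum_cameras_ge rkC) cJ.
pose J' := [set s | Some s \in J]%SET.
have JJ' : (#|J| <= #|J'|.+1)%N.
  apply: (@leq_trans #|None |: [set Some s | s in J']%SET|).
    apply/subset_leq_card/fintype.subsetP => -[s|] sJ; rewrite !inE //=.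
    by apply/imsetP; exists s; rewrite ?inE.
  by rewrite (leq_trans (leq_card_setU _ _)) // cards1 add1n ltnS leq_imset_card.
have /card_gt1P[a [b [aJ bJ ab]]] : (1 < #|J'|)%N by rewrite -ltnS (leq_trans J3).
rewrite !inE in aJ bJ.
have [J3'|J4] := leqP #|J| 3.
  apply: leq_trans J3' (leq_trans (rk2 a b ab) _).
  exact: (@rank_pair_le_sum _ _ _ _ C _ (camera_or idx j) J (Some a) (Some b)).
have JT s : s \in J.
  suff -> : J = [set: option 'I_3]%SET by rewrite inE.
  by apply/eqP; rewrite eqEcard finset.subsetT cardsT card_option card_ord.
apply: leq_trans (card_option_le J) (leq_trans rk3 _).
apply: mxrankS; apply/sumsmx_subP => s _.
exact: (sumsmx_sup (Some s)).
Qed.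

(** The third line is taken off the common point of two distinct ones if they
    meet, and arbitrarily otherwise. *)
Lemma chain_of_nonconcurrent_lines (I : {set 'I_n}) : (3 <= #|I|)%N ->
  {in I &, injective (fun i => center (C i))} -> ~ concurrent C I ->
  exists Z, irreducible_chain (multiview_variety C) 3 Z.
Proof.
move=> I3 Iinj Inc.
have rk2 i j : i \in I -> j \in I -> i != j -> (2 < \rank (C i + C j)%MS)%N.
  move=> iI jI; apply: contraNltn => ij; apply/eqP/Iinj => //.
  exact: eq_center_of_rank.
have /card_gt1P[i1 [i2 [i1I i2I i12]]] : (1 < #|I|)%N by apply: ltnW.
pose S := (C i1 + C i2)%MS.
have [i3 [i3I i31 i32 rk3]] : exists i3, [/\ i3 \in I, i3 != i1, i3 != i2 &
    (3 < \rank (S + C i3)%MS)%N].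
  have [S3|S4] := leqP (\rank S) 3; last first.
    have : (0 < #|I :\ i1 :\ i2|)%N.
      by move: I3; rewrite (cardsD1 i1) i1I (cardsD1 i2) !inE eq_sym i12 i2I.
    case/card_gt0P => i3; rewrite !inE => /and3P[i32 i31 i3I]; exists i3; split=> //.
    by apply: leq_trans S4 _; apply: mxrankS (addsmxSl _ _).
  have [v v0 Sv] := common_kernel_vector S3.
  have [i3 i3I i3S] : exists2 i3, i3 \in I & ~~ (C i3 <= S)%MS.
    apply: contrapT => no; apply: Inc; have [X Xv] := pspace_of v0.
    exists X => i iI; apply/(centerE _ Xv)/Sv; apply: contrapT => /negP iS.
    by apply: no; exists i.
  exists i3; split=> //.
  - by apply: contraNneq i3S => ->; apply: addsmxSl.
  - by apply: contraNneq i3S => ->; apply: addsmxSr.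
  apply: leq_ltn_trans (rk2 _ _ i1I i2I i12) _; rewrite ltn_neqAle.
  rewrite mxrankS ?addsmxSl // andbT; apply: contra i3S => rkE.
  have [_ e] := mxrank_leqif_sup (addsmxSl S (C i3)).
  by rewrite e in rkE; apply: submx_trans (addsmxSr _ _) rkE.
pose idx (a : 'I_3) := tnth [tuple i1; i2; i3] a.
have idxI a : idx a \in I.
  have : idx a \in [tuple i1; i2; i3] by apply: mem_tnth.
  by rewrite !inE => /or3P[]/eqP->.
apply: (chain_of_three_lines (idx := idx)).
  move=> a b ab; apply: rk2 => //; apply: contra_neq ab; move: a b.
  by apply/tuple_uniqP; rewrite /= !inE negb_or i12 eq_sym i31 eq_sym i32.
have sup a : (C (idx a) <= \sum_b <<C (idx b)>>)%MS.
  by rewrite (sumsmx_sup a) ?genmxE.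
apply: leq_trans rk3 _; apply: mxrankS; rewrite !addsmx_sub -andbA.
by apply/and3P; split;
  [exact: (sup (@Ordinal 3 0 isT))|exact: (sup (@Ordinal 3 1 isT))
  |exact: (sup (@Ordinal 3 2 isT))].
Qed.

End ThreeLines.

Theorem proposition4p1 (R : realType) (N h n : nat)
    (C : 'I_n -> 'M[R[i]]_(h.+1, N.+1)) :
  (1 <= N <= 3)%N -> (1 <= h <= N)%N -> (1 <= n)%N ->
  (forall i, \rank (C i) = h.+1) ->
  has_dim (multiview_variety C) N <->
  [\/ h = N,
      N = h.+1 /\
        exists i j : 'I_n, center (C i) `&` center (C j) = set0
    | N = h.+2 /\
        exists I : {set 'I_n},
          [/\ (3 <= #|I|)%N,
              {in I &, injective (fun i => center (C i))}
            & ~ concurrent C I]].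
Proof.
move=> /andP[_ N3] /andP[h1 hN] n0 rkC; split=> [[[Z Zch] _]|cases]; last first.
  split; last by move=> e Z; apply: chain_length_le_ambient.
  case: cases => [hN'|[Nh [i [j ij]]]|[Nh [I [I3 Iinj Inc]]]].
  - exact: chain_of_invertible_cameras.
  - exact: chain_of_disjoint_centers ij.
  have h1' : h = 1%N by apply/eqP; rewrite eqn_leq h1 andbT -ltnS -ltnS -Nh.
  subst h N; exact: chain_of_nonconcurrent_lines Iinj Inc.
have [hN'|hltN] := eqVneq h N; first by constructor 1.
have := hN; rewrite leq_eqVlt (negPf hltN) /= leq_eqVlt => /predU1P[Nh|hN2].
  constructor 2; split=> //; apply: contrapT => no.
  suff : (N <= h)%N by rewrite -Nh ltnn.
  apply: (meeting_centers_chain_length n0 rkC (esym Nh)) Zch => i j.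
  by apply/set0P; apply/eqP => ij; apply: no; exists i, j.
have h1' : h = 1%N.
  by apply/eqP; rewrite eqn_leq h1 andbT -ltnS -ltnS (leq_trans hN2).
have Nh : N = h.+2 by apply/eqP; rewrite eqn_leq hN2 h1' andbT.
constructor 3; split=> //; apply: contrapT => no.
by have := line_centers_chain_length n0 Nh h1' no Zch; rewrite Nh h1'.
Qed.
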